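(* Let $G=(V,E)$ be a connected undirected graph with $n=|V|$, let $G_F=(V,F)$ be a chordal extension of $G$, and let $\mathcal{K}$ be the set of all maximal cliques of $G_F$. Then for every integer $k$ with $2\le k\le n$, $$\operatorname{proj}_F\mathcal{F}=\mathcal{F}' ,$$ where $\mathcal{F}\subseteq\{0,1\}^{V^2}$ and $\mathcal{F}'\subseteq\{0,1\}^F$ are the sets defined by semidefinite constraints in the context.
   Context: All graphs are finite, simple and undirected. A graph is chordal if every cycle of length at least $4$ has a chord (an edge joining two nonconsecutive vertices of the cycle). A chordal extension of $G=(V,E)$ is a chordal graph $G_F=(V,F)$ with $E\subseteq F$. Cliques are identified with their vertex sets $C\subseteq V$; a clique is maximal if its vertex set is not a proper subset of another clique. The vertex set $V$ is totally ordered, and $V^2:=\{\{i,j\}\subseteq V: i<j\}$ denotes the set of edges of the complete graph on $V$ (so $|V^2|=n(n-1)/2$ and $F\subseteq V^2$). $J$ denotes the all-ones matrix, and $\mathbb{S}^m_+$ the cone of real symmetric positive semidefinite $m\times m$ matrices. For a matrix $M$ with rows and columns indexed by $V$ and $C\subseteq V$, $M_C$ denotes the principal submatrix with rows and columns indexed by $C$. For $y\in\{0,1\}^{V^2}$ let $Y$ be the symmetric $V\times V$ matrix with $Y_{ij}=Y_{ji}=y_{ij}$ for $i<j$ and $Y_{ii}=1$ for all $i\in V$. Define $$\mathcal{F}=\Big\{y\in\{0,1\}^{V^2}:\ \tfrac{-1}{k-1}J+\tfrac{k}{k-1}Y\in\mathbb{S}^n_+\Big\}.$$ For $y\in\{0,1\}^F$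 and $C\in\mathcal{K}$, let $Y_C$ be the symmetric $C\times C$ matrix with off-diagonal entries $Y_{ij}=Y_{ji}=y_{ij}$ (all pairs of distinct elements of $C$ belong to $F$) and $Y_{ii}=1$ for $i\in C$. Define $$\mathcal{F}'=\Big\{y\in\{0,1\}^{F}:\ \tfrac{-1}{k-1}J_{C}+\tfrac{k}{k-1}Y_{C}\in\mathbb{S}^{|C|}_+\ \text{ for all } C\in\mathcal{K}\Big\}.$$ For $S\subseteq\mathbb{R}^{V^2}$, $\operatorname{proj}_F S=\{y_F\in\mathbb{R}^F:\ \exists\, y_T\in\mathbb{R}^{V^2\setminus F},\ (y_F,y_T)\in S\}$. *)

(* Defs.v *)
From mathcomp Require Import all_boot all_order all_algebra.
From mathcomp Require Import classical_sets reals.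

Set Implicit Arguments.
Unset Strict Implicit.
Unset Printing Implicit Defensive.

Import Order.TTheory GRing.Theory Num.Theory.

(* An edge is a two-element set of vertices and a graph on V is given by its
   edge set.  As edges are unordered pairs, no order on V is needed. *)
Definition pairs (V : finType) : {set {set V}} := [set e : {set V} | #|e| == 2]%SET.

Definition simple_graph (V : finType) (E : {set {set V}}) : Prop :=
  E \subset pairs V.

(* Irreflexive when E is a simple graph, since [set i; i] is a singleton. *)
Definition adj (V : finType) (E : {set {set V}}) : rel V :=
  fun i j => [set i; j]%SET \in E.

Definition connected_graph (V : finType) (E : {set {set V}}) : Prop :=
  forall i j : V, connect (adj E) i j.

Definition chordal (V : finType) (E : {set {set V}}) : Prop :=
  forall c : seq V, cycle (adj E) c -> uniq c -> 4 <= size c ->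
  exists i j : V, [/\ i \in c, j \in c, adj E i j,
                      j != next c i & i != next c j].

Definition chordal_extension (V : finType) (E F : {set {set V}}) : Prop :=
  [/\ simple_graph F, chordal F & E \subset F].

Definition is_clique (V : finType) (E : {set {set V}}) (C : {set V}) : bool :=
  [forall i in C, forall j in C, (i != j) ==> adj E i j].

Definition maximal_cliques (V : finType) (E : {set {set V}}) : {set {set V}} :=
  [set C : {set V} | maxset (is_clique E) C]%SET.

Local Open Scope ring_scope.

Definition edge_vector (R : realType) (V : finType) (F : {set {set V}}) : Type :=
  {ffun {e : {set V} | e \in F} -> R}.

Definition zero_one (R : realType) (V : finType) (F : {set {set V}})
    (y : edge_vector R F) : Prop :=
  forall e, y e = 0 \/ y e = 1.

(* The coordinate of y at e; the value 0 off F is a dummy. *)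
Definition coord_at (R : realType) (V : finType) (F : {set {set V}})
    (y : edge_vector R F) (e : {set V}) : R :=
  if insub e is Some f then y f else 0.

(* The matrix Y_C, with rows and columns numbered by the enumeration of C.
   It is used only for C a clique of F, where the dummy value of coord_at
   does not occur. *)
Definition Ymx (R : realType) (V : finType) (F : {set {set V}})
    (y : edge_vector R F) (C : {set V}) : 'M[R]_#|C| :=
  \matrix_(i, j)
    if i == j then 1 else coord_at y [set enum_val i; enum_val j]%SET.

Definition psd (R : realType) (m : nat) (M : 'M[R]_m) : Prop :=
  M^T = M /\ forall x : 'cV[R]_m, 0 <= (x^T *m M *m x) 0 0.

Definition shifted_mx (R : realType) (k m : nat) (M : 'M[R]_m) : 'M[R]_m :=
  (-1 / (k%:R - 1)) *: const_mx 1 + (k%:R / (k%:R - 1)) *: M.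

Definition feasible (R : realType) (V : finType) (k : nat) :
    set (edge_vector R (pairs V)) :=
  [set y | zero_one y /\ psd (shifted_mx k (Ymx y [set: V]%SET))]%classic.

Definition clique_feasible (R : realType) (V : finType) (F : {set {set V}})
    (k : nat) : set (edge_vector R F) :=
  [set y | zero_one y /\
           forall C : {set V}, C \in maximal_cliques F ->
             psd (shifted_mx k (Ymx y C))]%classic.

(* The vector (y_F, y_T) with T the complement of F in the set of all pairs. *)
Definition glue (R : realType) (V : finType) (F : {set {set V}})
    (yF : edge_vector R F) (yT : edge_vector R (pairs V :\: F)) :
    edge_vector R (pairs V) :=
  [ffun e => if val e \in F then coord_at yF (val e) else coord_at yT (val e)].

Definition proj (R : realType) (V : finType) (F : {set {set V}})
    (S : set (edge_vector R (pairs V))) : set (edge_vector R F) :=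
  [set yF | exists yT : edge_vector R (pairs V :\: F), S (glue yF yT)]%classic.

Arguments feasible R V k : clear implicits.
Arguments clique_feasible R {V} F k.
Arguments proj {R V} F S.

(* Main.v *)
(** A 0/1 matrix with unit diagonal satisfies the semidefinite constraint
    exactly when it is the incidence matrix of an equivalence relation with at
    most k classes: test vectors (1, -1, 1) and (1, ..., 1) give one direction,
    the Cauchy-Schwarz inequality applied to the class sums the other.  A point
    of the right-hand side is thus a relation on the edges of F that is an
    equivalence with at most k classes on every clique.  Since a chordal graph
    has a perfect elimination order, such a relation is induced by a map
    V -> 'I_k, chosen greedily, and that map defines the missing
    coordinates. *)

Require Import Defs.
From mathcomp Require Import classical_sets reals.
From mathcomp Require Import all_boot all_order all_algebra.
From mathcomp Require Import zify ring lra.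

Set Implicit Arguments.
Unset Strict Implicit.
Unset Printing Implicit Defensive.

Import Order.TTheory GRing.Theory Num.Theory.

(** * Chordless paths and simplicial vertices of chordal graphs *)

(** A path of least length works: an edge from [a] to a later [b] lets the stretch [q2] between them
    be cut out, so minimality forces [q2] to be empty. *)
Lemma connect_induced_path (T : finType) (e : rel T) (x y : T) :
  connect e x y ->
  exists p, [/\ path e x p, last x p = y, uniq (x :: p) &
    forall q1 a q2 b q3, x :: p = q1 ++ a :: q2 ++ b :: q3 -> e a b ->
      q2 = [::]].
Proof.
move=> /connectP[p0 ep0 yp0].
pose Q n := [exists p : n.-tuple T,
  [&& path e x p, last x p == y & uniq (x :: p)]].
have exQ : exists n, Q n.
  case/shortenP: ep0 yp0 => p ep up _ yp.
  by exists (size p); apply/existsP; exists (in_tuple p); rewrite ep yp eqxx up.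
case: (ex_minnP exQ) => n /existsP[p /and3P[ep /eqP yp up]] minn.
exists p; split=> // q1 a q2 b q3 defp eab.
have [q' [eq' lq' uq' szq']] : exists q', [/\ path e x q', last x q' = y,
    uniq (x :: q') & (size q' + size q2 = size p)%N].
  case: q1 defp => [|z q1] /= [defx defp]; subst.
    exists (b :: q3); split.
    - by move: ep; rewrite defp cat_path /= eab => /and3P[].
    - by move: yp; rewrite defp last_cat.
    - rewrite -cons_uniq; apply: (subseq_uniq _ up); rewrite defp /= eqxx.
      exact: suffix_subseq.
    - by rewrite defp !size_cat /= addnC.
  exists (q1 ++ a :: b :: q3); split.
  - by move: ep; rewrite defp !cat_path /= cat_path /= eab => /and5P[-> -> _ _ ->].
  - by move: yp; rewrite defp !last_cat /= last_cat.
  - rewrite -cons_uniq; apply: (subseq_uniq _ up); rewrite defp /= eqxx.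
    by rewrite cat_subseq //= eqxx suffix_subseq.
  - by rewrite defp !size_cat /= size_cat /=; lia.
have /minn : Q (size q').
  by apply/existsP; exists (in_tuple q'); rewrite eq' lq' eqxx uq'.
move=> len; have := size_tuple p; case: q2 szq' {defp} => //= *; lia.
Qed.

Lemma adjC (V : finType) (F : {set {set V}}) i j : adj F i j = adj F j i.
Proof. by rewrite /adj setUC. Qed.

Lemma adj_irr (V : finType) (F : {set {set V}}) i :
  simple_graph F -> ~~ adj F i i.
Proof.
by move=> sF; apply/negP=> /(subsetP sF); rewrite inE setUid cards1.
Qed.

Lemma is_cliqueP (V : finType) (F : {set {set V}}) (C : {set V}) :
  reflect {in C &, forall i j, i != j -> adj F i j} (is_clique F C).
Proof.
apply: (iffP forall_inP) => [H i j iC jC ij | H i iC].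
  by have /forall_inP/(_ j jC)/implyP := H i iC; apply.
by apply/forall_inP=> j jC; apply/implyP; apply: H.
Qed.

(* A non-adjacent pair x, y would close, through v and a shortest path inside
   A, a chordless cycle of length at least 4. *)
Lemma chordal_attachments_adj (V : finType) (F : {set {set V}}) (v x y : V)
    (A : {set V}) :
  simple_graph F -> chordal F -> v \notin A ->
  {in A, forall a, ~~ adj F v a} -> adj F v x -> adj F v y -> x != y ->
  connect [rel a b | [&& a \in x |: (y |: A), b \in x |: (y |: A) & adj F a b]]
    x y ->
  adj F x y.
Proof.
move=> sF cF vA nvA vx vy xy; set B := x |: (y |: A) => /connect_induced_path.
case=> p [ep lp up indp]; apply/negPn/negP=> nxy.
have vB : v \notin B.
  rewrite !inE (negPf vA) orbF; apply/norP; split; apply/eqP=> vE.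
    by have := adj_irr x sF; rewrite -{1}vE vx.
  by have := adj_irr y sF; rewrite -{1}vE vy.
have pB : {subset x :: p <= B}.
  apply/allP => /=; rewrite !inE eqxx /=.
  have path_in z q : path [rel a b | [&& a \in B, b \in B & adj F a b]] z q ->
    all (mem B) q by elim: q z => //= w q IH z /andP[/and3P[_ -> _] /IH].
  exact: path_in ep.
have adjp : path (adj F) x p by apply: sub_path ep => a b /and3P[].
have uc : uniq [:: v, x & p].
  by rewrite cons_uniq up andbT; apply: contra vB => /pB.
(* As [y] ends the list, its index overruns the tail, and the default value of [nth], the head [v],
   closes the cycle. *)
have nexty : next [:: v, x & p] y = v.
  rewrite next_nth -lp mem_behead ?mem_last //=.
  rewrite ifN; last by apply: contraNneq vB => ->; apply: pB; apply: mem_last.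
  by have /= -> := index_last up; rewrite nth_default.
(* No chord starts at [v]: it has no neighbour in [A], and [x] and [y] are its two neighbours on the
   cycle. *)
have chord_v j : j \in [:: v, x & p] -> adj F v j ->
    j = next [:: v, x & p] v \/ v = next [:: v, x & p] j.
  rewrite inE => /orP[/eqP-> | /pB]; first by rewrite (negPf (adj_irr v sF)).
  rewrite !inE => /or3P[/eqP-> _|/eqP-> _|/nvA/negPf->] //.
    by left; rewrite /= eqxx.
  by right.
(* No chord joins two vertices of the path: the path is induced, so adjacent vertices are
   consecutive on it. *)
have chord_p q1 i q2 j q3 : x :: p = q1 ++ i :: q2 ++ j :: q3 -> adj F i j ->
    j = next [:: v, x & p] i.
  move=> defp ij; have ip : i \in x :: p by rewrite defp mem_cat inE eqxx orbT.
  have jp : j \in x :: p by rewrite defp !(mem_cat, inE) eqxx !orbT.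
  have q20 : q2 = [::] by apply: (indp _ _ _ _ _ defp); rewrite /= !pB.
  move: uc defp; rewrite {}q20 => uc defp.
  rewrite next_nth mem_behead //; move: uc; rewrite defp => /=.
  rewrite cat_uniq /= !mem_cat !inE !negb_or => /and3P[].
  case/and3P=> _ vi _ _ /andP[/andP[iq1 _] _].
  rewrite (negPf vi) index_cat (negPf iq1) /= eqxx addn0.
  by rewrite nth_cat ltnNge leqnSn /= subSnn.
have [] := cF [:: v, x & p] _ uc.
- rewrite /= rcons_path vx adjp lp /= adjC; exact: vy.
(* The cycle has length at least 4: an empty [p] would give [x = y], and a single vertex would make
   [x] and [y] adjacent. *)
- case: p lp {ep up indp pB uc nexty chord_v chord_p} adjp => [/= E|z [|//]].
    by rewrite E eqxx in xy.
  by move=> /= -> /andP[E]; rewrite E in nxy.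
move=> i [j [ic jc ij nij nji]].
have [iv|iv] := eqVneq i v.
  rewrite iv in ij nij nji.
  by case: (chord_v j jc ij) => E; [case/eqP: nij | case/eqP: nji].
have [jv|jv] := eqVneq j v.
  rewrite jv adjC in ij nij nji.
  by case: (chord_v i ic ij) => E; [case/eqP: nji | case/eqP: nij].
move: ic jc; rewrite ![_ \in v :: _]in_cons (negPf iv) (negPf jv) !orFb => ip jp.
case/splitPr: {-1}_ / ip (erefl (x :: p)) => q1 r defp.
move: jp; rewrite defp mem_cat inE => /or3P[jq|/eqP ji|jr].
- case/splitPr: jq defp => q3 q4; rewrite -catA => defp.
  by case/eqP: nji; apply: chord_p defp _; rewrite adjC.
- by move: ij; rewrite ji (negPf (adj_irr i sF)).
- case/splitPr: jr defp => q3 q4 defp.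
  by case/eqP: nij; apply: chord_p defp _.
Qed.

(* For a non-universal vertex v, the attachment set S' of a component A of the
   non-neighbours of v is a clique by chordality; a simplicial vertex of
   A :|: S' outside S' has no neighbour outside A :|: S'. *)
Lemma simplicial_vertex (V : finType) (F : {set {set V}}) (U S : {set V}) :
  simple_graph F -> chordal F -> S \proper U -> is_clique F S ->
  exists2 u, u \in U :\: S & is_clique F [set w in U | adj F u w].
Proof.
move=> sF cF; have [n] := ubnP #|U|.
elim: n => // n IH in U S *; rewrite ltnS => leUn ltSU clS.
have [clU | nclU] := boolP (is_clique F U).
  have /properP[_ [u uU uS]] := ltSU; exists u; first by rewrite inE uS.
  apply/is_cliqueP=> i j; rewrite !inE => /andP[iU _] /andP[jU _].
  by move/is_cliqueP: clU; apply.
have [sSU _] := properP ltSU.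
pose univ z := [forall t in U, (t != z) ==> adj F z t].
(* A non-universal vertex of [S] is preferred. Either alternative keeps every vertex other than [v]
   and not adjacent to [v] out of [S]: if [v] is in [S] because [S] is a clique, otherwise because
   the vertices of [S] are universal. *)
have [v [vU nuv vS]] : exists v, [/\ v \in U, ~~ univ v &
    v \in S \/ {in S, forall s, univ s}].
  have [/exists_inP[v vS nuv] | nex] := boolP [exists s in S, ~~ univ s].
    by exists v; split=> //; [apply: (subsetP sSU) | left].
  have uS : {in S, forall s, univ s}.
    by move=> s sS; apply: contraNT nex => nus; apply/exists_inP; exists s.
  have [/exists_inP[v vU nuv] | nexU] := boolP [exists s in U, ~~ univ s].
    by exists v; split=> //; right.
  case/negP: nclU; apply/is_cliqueP=> i j iU jU ij.
  have : univ i by apply: contraNT nexU => nui; apply/exists_inP; exists i.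
  by move=> /forall_inP/(_ j jU); rewrite eq_sym ij.
pose W := [set z in U | (z != v) && ~~ adj F v z].
have [w wW] : exists w, w \in W.
  case/forall_inPn: nuv => w wU; rewrite negb_imply => wP.
  by exists w; rewrite inE wU.
pose r := [rel a b | [&& a \in W, b \in W & adj F a b]].
have symr : symmetric r by move=> a b; rewrite /= adjC andbCA.
pose A := [set z | connect r w z].
pose S' := [set s in U | (s \notin A) && [exists a in A, adj F a s]].
have wA : w \in A by rewrite inE connect0.
have stepA a b : a \in A -> r a b -> b \in A.
  by rewrite inE => wa ab; rewrite inE; apply: connect_trans wa _; apply: connect1.
have AW : {subset A <= W}.
  move=> z; rewrite inE => /connectP[p rp ->].
  by elim/last_ind: p rp => //= p t _; rewrite rcons_path last_rcons => /andP[_ /and3P[]].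
have AU : {subset A <= U} by move=> z /AW; rewrite inE => /andP[].
have vA : v \notin A by apply/negP=> /AW; rewrite inE eqxx andbF.
have nvA : {in A, forall a, ~~ adj F v a} by move=> a /AW; rewrite inE => /and3P[].
(* A non-neighbour of [v] attached to [A] would lie in [W], hence in the component [A] itself. *)
have vS' s : s \in S' -> adj F v s.
  rewrite inE => /and3P[sU nsA /exists_inP[a aA as_]].
  apply: contraNT nsA => nvs; apply: (stepA a) => //=.
  rewrite AW // as_ inE sU nvs !andbT /=.
  by apply: contraTneq as_ => ->; rewrite adjC nvA.
have connA (B : {set V}) a b : A \subset B -> a \in A -> b \in A ->
    connect [rel a b | [&& a \in B, b \in B & adj F a b]] a b.
  move=> sAB aA bA; have : connect r a b.
    have wa : connect r w a by move: aA; rewrite inE.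
    have wb : connect r w b by move: bA; rewrite inE.
    by apply: connect_trans wb; rewrite (sym_connect_sym symr).
  case/connectP=> p rp ->; elim: p a aA rp {b bA} => //= t p IHp a aA.
  case/andP=> rat rp; have tA := stepA _ _ aA rat.
  apply: connect_trans (IHp t tA rp); apply: connect1 => /=.
  by rewrite !(subsetP sAB) //; case/and3P: rat.
have clS' : is_clique F S'.
  apply/is_cliqueP=> x y xS yS xy.
  apply: (chordal_attachments_adj sF cF vA nvA (vS' _ xS) (vS' _ yS) xy).
  move: xS yS; rewrite !inE => /and3P[_ _ /exists_inP[a aA ax]].
  case/and3P=> _ _ /exists_inP[b bA yb].
  set B := x |: _; have sAB : A \subset B by rewrite /B setUA subsetUr.
  apply: (@connect_trans _ _ a).
    by apply: connect1; rewrite /= (subsetP sAB _ aA) !inE eqxx adjC.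
  apply: (connect_trans (connA B a b sAB aA bA)).
  by apply: connect1; rewrite /= (subsetP sAB _ bA) !inE eqxx orbT.
(* The set shrinks because [v] is in neither [A] nor [S']. This call is why the statement lets a
   clique be avoided: avoiding [S'] forces [u] into [A]. *)
have [||u] := IH (A :|: S') S' _ _ clS'.
- apply: leq_trans leUn; apply/proper_card/properP; split.
    by rewrite subUset; apply/andP; split; apply/subsetP=> // z; rewrite inE => /andP[].
  exists v; rewrite // inE (negPf vA) /=.
  by apply/negP=> /vS'; apply/negP; apply: adj_irr.
- by apply/properP; split; [apply: subsetUr | exists w; rewrite in_set ?wA ?andbF].
rewrite !inE => /andP[nuS' /orP[uA|uS']] clu; last by rewrite uS' in nuS'.
have {}uA : u \in A by rewrite inE.
exists u.
  rewrite inE (AU _ uA) andbT; have := AW _ uA; rewrite inE => /and3P[uU uv nvu].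
  case: vS => [vS | uni]; apply/negP=> uS.
    by move/is_cliqueP: clS => /(_ v u vS uS); rewrite eq_sym uv (negPf nvu) => /(_ isT).
  by have /forall_inP/(_ v vU) := uni u uS; rewrite eq_sym uv adjC (negPf nvu).
suff -> : [set t in U | adj F u t] = [set t in A :|: S' | adj F u t] by [].
apply/setP=> t; rewrite ![t \in [set _ in _ | _]]inE.
have [ut|] := boolP (adj F u t); rewrite ?andbF // !andbT in_setU.
have [/AU->//|tA] := boolP (t \in A); rewrite orFb [RHS]inE tA.
suff -> : [exists a in A, adj F a t] by rewrite !andbT.
by apply/exists_inP; exists u.
Qed.

(** * Colouring a chordal graph along a relation *)

(* Colours are chosen one vertex at a time, along a perfect elimination order
   read backwards: a vertex sees only a clique of already coloured vertices. *)
Lemma chordal_colouring (V : finType) (F : {set {set V}}) (k : nat)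
    (Y : rel V) :
  simple_graph F -> chordal F -> 0 < k -> reflexive Y -> symmetric Y ->
  (forall C, is_clique F C -> {in C & &, transitive Y}) ->
  (forall C, is_clique F C -> {in C &, forall i j, i != j -> ~~ Y i j} ->
     #|C| <= k) ->
  exists f : V -> 'I_k, forall i j, adj F i j -> (f i == f j) = Y i j.
Proof.
move=> sF cF k0 Yrefl Ysym Ytrans Yind.
suff [f Hf] : exists f : V -> 'I_k, {in [set: V] &, forall i j, adj F i j ->
    (f i == f j) = Y i j} by exists f => i j; apply: Hf; rewrite inE.
have [n] := ubnP #|[set: V]|; elim: n [set: V] => // n IH U; rewrite ltnS => leU.
have [->|[u0 u0U]] := set_0Vmem U.
  by exists (fun=> Ordinal k0) => i j; rewrite inE.
have [||u] := @simplicial_vertex V F U set0 sF cF.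
- by apply/properP; split; [apply: sub0set | exists u0; rewrite // inE].
- by apply/is_cliqueP=> i j; rewrite inE.
rewrite setD0 => uU clN; set N := [set w in U | adj F u w] in clN.
have uN : u \notin N by rewrite inE (negPf (adj_irr u sF)) andbF.
have clK : is_clique F (u |: N).
  apply/is_cliqueP=> i j; rewrite !inE => /orP[/eqP->|/andP[iU ui]].
    by case/orP=> [/eqP->|/andP[_ uj] _ //]; rewrite eqxx.
  case/orP=> [/eqP->|/andP[jU uj] ij]; first by rewrite adjC.
  by move/is_cliqueP: clN; apply; rewrite ?inE ?iU ?jU.
have [|f Hf] := IH (U :\ u).
  by apply: leq_trans leU; rewrite [in leqRHS](cardsD1 u) uU.
(* With the rest of [U] coloured, only the neighbours [N] of [u] constrain its colour. *)
suff [c Hc] : exists c, {in N, forall l, (c == f l) = Y u l}.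
  exists (fun v => if v == u then c else f v) => i j iU jU ij.
  have [iu|iu] := eqVneq i u; have [ju|ju] := eqVneq j u.
  - by rewrite iu ju (negPf (adj_irr u sF)) in ij.
  - by rewrite iu Hc // inE jU -iu.
  - by rewrite ju eq_sym Ysym Hc // inE iU -ju adjC.
  - by apply: Hf; rewrite // !inE ?iu ?ju.
have HfN : {in N &, forall i j, i != j -> (f i == f j) = Y i j}.
  move=> i j iN jN ij; apply: Hf.
  - by move: iN uN; rewrite !inE => /andP[-> ui]; case: eqP ui => // -> ->; rewrite uU.
  - by move: jN uN; rewrite !inE => /andP[-> uj]; case: eqP uj => // -> ->; rewrite uU.
  - by move/is_cliqueP: clN; apply.
(* If [u] is related to some [j] in [N], the colour of [j] is right by transitivity on the clique
   [u |: N]; otherwise a colour absent from [N] is wanted. *)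
have [/exists_inP[j jN uj] | nY] := boolP [exists j in N, Y u j].
  exists (f j) => l lN; have [<-|jl] := eqVneq j l; first by rewrite eqxx uj.
  rewrite HfN //; have [uK jK lK] : [/\ u \in u |: N, j \in u |: N & l \in u |: N].
    by rewrite !in_setU1 eqxx jN lN !orbT.
  apply/idP/idP; first exact: (Ytrans _ clK).
  by apply: (Ytrans _ clK) => //; rewrite Ysym.
have nYl l : l \in N -> Y u l = false.
  by move=> lN; apply: contraNF nY => ul; apply/exists_inP; exists l.
have [/existsP[c cN] | full] := boolP [exists c, c \notin f @: N].
  exists c => l lN; rewrite nYl //; apply: contraNF cN => /eqP->.
  exact: imset_f.
(* If [N] uses all [k] colours, one representative of each together with [u] gives [k + 1] pairwise
   unrelated vertices in a clique, against [Yind]. *)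
have rP c : exists l, (l \in N) && (f l == c).
  have : c \in f @: N by apply: contraNT full => cN; apply/existsP; exists c.
  by case/imsetP=> l lN ->; exists l; rewrite lN eqxx.
pose r c := xchoose (rP c).
have rN c : r c \in N by case/andP: (xchooseP (rP c)).
have fr c : f (r c) = c by case/andP: (xchooseP (rP c)) => _ /eqP.
have sRN : r @: 'I_k \subset N by apply/subsetP=> _ /imsetP[c _ ->].
have : #|u |: r @: 'I_k| <= k.
  apply: Yind.
    apply/is_cliqueP=> i j iR jR; move/is_cliqueP: clK; apply.
      exact: (subsetP (setUS _ sRN)).
    exact: (subsetP (setUS _ sRN)).
  move=> i j /setU1P[->|/imsetP[c _ ->]] /setU1P[->|/imsetP[d _ ->]].
  - by rewrite eqxx.
  - by rewrite nYl.
  - by rewrite Ysym nYl.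
  - by move=> rcd; rewrite -HfN // !fr; apply: contraNneq rcd => ->.
rewrite cardsU1 (contra (subsetP sRN u) uN) card_imset ?card_ord ?ltnn //.
exact: can_inj fr.
Qed.

Local Open Scope ring_scope.

(** * The semidefinite constraint as an inequality on a relation *)

Definition same_block (R : realType) (V : finType) (F : {set {set V}})
    (y : edge_vector R F) : rel V :=
  fun i j => (i == j) || (coord_at y [set i; j] == 1).

Lemma same_block_refl (R : realType) (V : finType) (F : {set {set V}})
    (y : edge_vector R F) : reflexive (same_block y).
Proof. by move=> i; rewrite /same_block eqxx. Qed.

Lemma same_block_sym (R : realType) (V : finType) (F : {set {set V}})
    (y : edge_vector R F) : symmetric (same_block y).
Proof. by move=> i j; rewrite /same_block eq_sym setUC. Qed.

Lemma coord_at_zero_one (R : realType) (V : finType) (F : {set {set V}})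
    (y : edge_vector R F) e :
  zero_one y -> coord_at y e = (coord_at y e == 1)%:R.
Proof.
rewrite /coord_at => y01; case: insub => [f|]; last by rewrite eq_sym oner_eq0.
by case: (y01 f) => ->; rewrite ?eqxx // eq_sym oner_eq0.
Qed.

Lemma YmxE (R : realType) (V : finType) (F : {set {set V}})
    (y : edge_vector R F) (C : {set V}) :
  zero_one y ->
  Ymx y C = \matrix_(i, j) (same_block y (enum_val i) (enum_val j))%:R.
Proof.
move=> y01; apply/matrixP=> i j; rewrite !mxE /same_block (inj_eq enum_val_inj).
by case: eqP => //= _; apply: coord_at_zero_one.
Qed.

(** For [k > 1] this is the semidefinite constraint multiplied by [k - 1]. Test vectors are indexed
    by [V] rather than by the enumeration of [C], so that different sets [C] can be compared. *)
Definition block_psd (R : realType) (V : finType) (k : nat) (Y : rel V)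
    (C : {set V}) : Prop :=
  forall x : V -> R, (\sum_(i in C) x i) ^+ 2 <=
    k%:R * \sum_(i in C) \sum_(j in C) x i * x j * (Y i j)%:R.

Lemma shifted_mx_form (R : realType) (V : finType) (k : nat) (Y : rel V)
    (C : {set V}) (x : V -> R) :
  let X := \col_i x (@enum_val V (mem C) i) in
  let M := \matrix_(i, j) (Y (enum_val i) (enum_val j))%:R : 'M[R]_#|C| in
  (X^T *m shifted_mx k M *m X) 0 0 =
  (k%:R * (\sum_(i in C) \sum_(j in C) x i * x j * (Y i j)%:R)
     - (\sum_(i in C) x i) ^+ 2) / (k%:R - 1).
Proof.
move=> X M.
transitivity (\sum_(j in C) \sum_(i in C)
    x i * (-1 / (k%:R - 1) + k%:R / (k%:R - 1) * (Y i j)%:R) * x j).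
  rewrite mxE [RHS]big_enum_val; apply: eq_bigr => j _.
  rewrite [RHS]big_enum_val !mxE mulr_suml; apply: eq_bigr => i _.
  by rewrite !mxE mulr1.
rewrite exchange_big expr2 /= mulr_suml mulr_sumr -sumrB mulr_suml.
apply: eq_bigr => i _; rewrite !mulr_sumr -sumrB mulr_suml.
by apply: eq_bigr => j _; ring.
Qed.

Lemma block_psdP (R : realType) (V : finType) (F : {set {set V}}) (k : nat)
    (y : edge_vector R F) (C : {set V}) :
  (1 < k)%N -> zero_one y ->
  psd (shifted_mx k (Ymx y C)) <-> block_psd R k (same_block y) C.
Proof.
move=> k1 y01; rewrite YmxE //.
have k1R : 0 < (k%:R - 1 : R)^-1 by rewrite invr_gt0 subr_gt0 ltr1n.
split=> [[_ psdM] x | psdC].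
  have := psdM (\col_i x (enum_val i)).
  by rewrite shifted_mx_form pmulr_lge0 // subr_ge0.
split=> [|X]; first by apply/matrixP=> i j; rewrite !mxE same_block_sym.
(* The sum has at most one term: it carries [X] over to [V] and is 0 outside [C]. *)
pose x v := \sum_(i | enum_val i == v :> V) X i 0.
have -> : X = \col_i x (enum_val i).
  apply/matrixP=> i j; rewrite !mxE ord1 /x (big_pred1 i) // => l.
  exact: (inj_eq enum_val_inj).
by rewrite shifted_mx_form pmulr_lge0 // subr_ge0.
Qed.

(** A principal submatrix of a semidefinite matrix is semidefinite: test vectors are extended by
    zero. *)
Lemma block_psdS (R : realType) (V : finType) (k : nat) (Y : rel V)
    (C D : {set V}) :
  C \subset D -> block_psd R k Y D -> block_psd R k Y C.
Proof.
move=> sCD psdD x.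
pose z i := if i \in C then x i else 0.
have restr (G : V -> R) : \sum_(i in D) (if i \in C then G i else 0) = \sum_(i in C) G i.
  rewrite -big_mkcondr; apply: eq_bigl => i.
  by have [/(subsetP sCD)->|] := boolP (i \in C); rewrite ?andbF.
have := psdD z; rewrite restr; congr (_ <= _ * _).
rewrite -restr; apply: eq_bigr => i _; rewrite /z; case: ifP => iC; last first.
  by apply: big1 => j _; rewrite !mul0r.
by rewrite -restr; apply: eq_bigr => j _; case: ifP; rewrite // mulr0 mul0r.
Qed.

Lemma block_psd_trans (R : realType) (V : finType) (k : nat) (Y : rel V)
    (C : {set V}) :
  reflexive Y -> symmetric Y -> block_psd R k Y C -> {in C & &, transitive Y}.
Proof.
move=> Yrefl Ysym psdC j i l jC iC lC ij jl; apply: contraTT isT => il.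
have lj : l != j by apply: contraNneq il => ->.
have ji : j != i by apply: contraNneq il => <-.
have li : l != i by apply: contraNneq il => ->; apply: Yrefl.
have sTC : [set j; i; l] \subset C by rewrite !subUset !sub1set jC iC.
(* At the vector (1, -1, 1) on (i, j, l) the inequality reads 1 <= - k. *)
have := block_psdS sTC psdC (fun v => if v == j then -1 else 1).
rewrite -setUA !(big_setU1, big_set1) ?inE ?negb_or ?(eq_sym j l) ?lj ?ji 1?eq_sym ?li //=.
rewrite !eqxx (negPf ji) (negPf lj) !Yrefl (Ysym j i) ij jl (Ysym l j) jl.
rewrite (Ysym l i) (negPf il) /=.
have := ler0n R k; nra.
Qed.

(** Only the diagonal terms survive on pairwise unrelated vertices, so the all-ones vector gives
    [#|C| ^ 2 <= k * #|C|]. *)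
Lemma block_psd_card (R : realType) (V : finType) (k : nat) (Y : rel V)
    (C : {set V}) :
  reflexive Y -> block_psd R k Y C ->
  {in C &, forall i j, i != j -> ~~ Y i j} -> (#|C| <= k)%N.
Proof.
move=> Yrefl /(_ (fun=> 1)) psdC indC.
have [->//|C0] := posnP #|C|.
move: psdC; rewrite [X in _ * X](_ : _ = #|C|%:R); last first.
  rewrite -sumr_const; apply: eq_bigr => i iC.
  rewrite (bigD1 i) //= Yrefl big1 ?addr0 ?mul1r // => j /andP[jC ji].
  by rewrite (negPf (indC i j iC jC _)) ?mulr0 // eq_sym.
by rewrite sumr_const expr2 -!natrM ler_nat leq_pmul2r.
Qed.

(** Cauchy-Schwarz against the all-ones vector, by Lagrange's identity: the two sides differ by half
    the sum of all [(s c - s d) ^+ 2]. *)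
Lemma sqr_sum_le (R : realDomainType) (k : nat) (s : 'I_k -> R) :
  (\sum_i s i) ^+ 2 <= k%:R * \sum_i s i ^+ 2.
Proof.
have : 0 <= \sum_c \sum_d (s c - s d) ^+ 2.
  by apply: sumr_ge0 => c _; apply: sumr_ge0 => d _; apply: sqr_ge0.
have -> : \sum_c \sum_d (s c - s d) ^+ 2 =
    2 * (k%:R * (\sum_c s c ^+ 2) - (\sum_c s c) ^+ 2).
  transitivity (\sum_c (k%:R * s c ^+ 2 + \sum_d s d ^+ 2
                       - 2 * s c * \sum_d s d)).
    apply: eq_bigr => c _.
    transitivity (\sum_d (s c ^+ 2 + s d ^+ 2 - 2 * s c * s d)).
      by apply: eq_bigr => d _; ring.
    rewrite sumrB big_split /= sumr_const card_ord mulr_sumr.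
    by rewrite -[_ ^+ 2 *+ k]mulr_natl.
  rewrite sumrB big_split /= -mulr_sumr sumr_const card_ord -mulr_suml -mulr_sumr.
  by rewrite -[_ *+ k]mulr_natl; ring.
by rewrite pmulr_rge0 // subr_ge0.
Qed.

(** Grouped by colour, the quadratic form is the sum of the squares of the [k] class sums. *)
Lemma colouring_block_psd (R : realType) (V : finType) (k : nat)
    (f : V -> 'I_k) (C : {set V}) :
  block_psd R k (fun i j => f i == f j) C.
Proof.
move=> x; pose s c := \sum_(i in C | f i == c) x i.
have -> : \sum_(i in C) x i = \sum_c s c.
  by rewrite (partition_big f predT).
have -> : \sum_(i in C) \sum_(j in C) x i * x j * (f i == f j)%:R =
    \sum_c s c ^+ 2.
  rewrite (partition_big f predT) //=; apply: eq_bigr => c _.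
  rewrite expr2 [RHS]mulr_suml; apply: eq_bigr => i /andP[_ /eqP<-].
  rewrite mulr_sumr big_mkcondr; apply: eq_bigr => j _.
  by rewrite eq_sym; case: eqP; rewrite ?mulr1 ?mulr0.
exact: sqr_sum_le.
Qed.

Lemma eq_block_psd (R : realType) (V : finType) (k : nat) (Y Z : rel V)
    (C : {set V}) :
  {in C &, Y =2 Z} -> block_psd R k Y C -> block_psd R k Z C.
Proof.
move=> YZ psdY x; have := psdY x; congr (_ <= _ * _).
by apply: eq_bigr => i iC; apply: eq_bigr => j jC; rewrite YZ.
Qed.

(** * Projection and completion of vectors *)

Lemma coord_at_val (R : realType) (V : finType) (F : {set {set V}})
    (y : edge_vector R F) (e : {e : {set V} | e \in F}) :
  coord_at y (val e) = y e.
Proof. by rewrite /coord_at valK. Qed.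

Lemma coord_at_glue (R : realType) (V : finType) (F : {set {set V}})
    (yF : edge_vector R F) (yT : edge_vector R (pairs V :\: F)) e :
  e \in pairs V ->
  coord_at (glue yF yT) e = if e \in F then coord_at yF e else coord_at yT e.
Proof. by move=> eV; rewrite [LHS]/coord_at insubT ffunE. Qed.

Lemma mem_pairs (V : finType) (i j : V) : ([set i; j] \in pairs V) = (i != j).
Proof. by rewrite inE cards2 eqSS eqb1. Qed.

Lemma proj_feasible_sub (R : realType) (V : finType) (F : {set {set V}})
    (k : nat) (y : edge_vector R F) :
  simple_graph F -> (1 < k)%N ->
  proj F (feasible R V k) y -> clique_feasible R F k y.
Proof.
move=> sF k1 [yT [g01 psdg]].
have y01 : zero_one y.
  move=> e; have eV : val e \in pairs V by apply: (subsetP sF) (valP e).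
  have := g01 (Sub (val e) eV).
  by rewrite -coord_at_val coord_at_glue SubK // (valP e) coord_at_val.
split=> // C; rewrite inE => /maxsetp/is_cliqueP clC.
(* The full constraint restricts to [C], and on a clique of [F] the glued vector only shows
   coordinates of [y]. *)
apply/block_psdP => //; move/block_psdP: psdg => /(_ k1 g01).
move/(block_psdS (subsetT C)); apply: eq_block_psd => i j iC jC.
rewrite /same_block; have [//|ij] := eqVneq i j.
have ijF : [set i; j] \in F by apply: clC.
by rewrite coord_at_glue ?mem_pairs // ijF.
Qed.

Lemma clique_feasible_sub (R : realType) (V : finType) (F : {set {set V}})
    (k : nat) (y : edge_vector R F) :
  simple_graph F -> chordal F -> (1 < k)%N ->
  clique_feasible R F k y -> proj F (feasible R V k) y.
Proof.
move=> sF cF k1 [y01 psdy].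
(* The colouring lemma asks about all cliques; each lies in a maximal one and inherits its
   constraint. *)
have psdC C : is_clique F C -> block_psd R k (same_block y) C.
  case/maxset_exists=> D maxD sCD; apply: block_psdS sCD _.
  by apply/block_psdP => //; apply: psdy; rewrite inE.
have [|||C|C|f Hf] := @chordal_colouring V F k (same_block y) sF cF.
- exact: ltnW.
- exact: same_block_refl.
- exact: same_block_sym.
- by move/psdC; apply: block_psd_trans; [apply: same_block_refl | apply: same_block_sym].
- by move/psdC; apply: block_psd_card; apply: same_block_refl.
(* A missing coordinate is 1 exactly on monochromatic pairs; quantifying over [e] avoids naming its
   two ends. *)
pose mono (e : {set V}) := [forall u in e, forall v in e, f u == f v].
pose yT : edge_vector R (pairs V :\: F) :=
  [ffun e : {e | e \in pairs V :\: F} => (mono (val e))%:R : R].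
have yT01 : zero_one yT by move=> e; rewrite ffunE; case: (mono _); [right | left].
exists yT.
have g01 : zero_one (glue y yT).
  move=> e; rewrite ffunE; case: ifP => _.
    by rewrite coord_at_zero_one //; case: (_ == _); [right | left].
  by rewrite coord_at_zero_one //; case: (_ == _); [right | left].
split=> //; apply/block_psdP => //.
(* It remains to see that the glued vector encodes equality of colours: on [F] by the choice of [f],
   off [F] by the definition of [yT]. *)
apply: (eq_block_psd _ (colouring_block_psd f setT)) => i j _ _.
rewrite /same_block; have [->|ij] := eqVneq i j; first exact: eqxx.
rewrite coord_at_glue ?mem_pairs //; case: ifP => ijF /=.
  by rewrite Hf // /same_block (negPf ij).
have ijT : [set i; j] \in pairs V :\: F by rewrite inE ijF mem_pairs.
rewrite /coord_at insubT ffunE /=.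
have -> : mono [set i; j] = (f i == f j).
  apply/forall_inP/eqP => [H | fij u].
    have /forall_inP/(_ j) := H i (set21 i j).
    by rewrite set22 => /(_ isT)/eqP.
  by move=> uij; apply/forall_inP=> v; move: uij; rewrite !inE
    => /orP[]/eqP-> /orP[]/eqP->; rewrite ?fij.
by case: (f i == f j); rewrite ?eqxx // eq_sym oner_eq0.
Qed.

Local Close Scope ring_scope.

Theorem theorem2 (R : realType) (V : finType) (E F : {set {set V}}) :
  simple_graph E -> connected_graph E -> chordal_extension E F ->
  forall k : nat, 2 <= k <= #|V| ->
  proj F (feasible R V k) = clique_feasible R F k.
Proof.
move=> _ _ [sF cF _] k /andP[k1 _]; apply/seteqP; split=> y.
  exact: proj_feasible_sub.
exact: clique_feasible_sub.
Qed.
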